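(* Let $p$ be an odd prime, let $H,N$ be integers with $0\le H<H+N<p$, and let $\ell\ge1$ be a fixed integer. Let $I_\ell(H,N)$ denote the number of solutions of the congruence $$\prod_{i=1}^{\ell}n_i!\equiv\prod_{i=\ell+1}^{2\ell}n_i!\pmod p,\qquad H+1\le n_1,\dots,n_{2\ell}\le H+N.$$ Then $$I_\ell(H,N)\ll N^{2\ell-1+2^{-\ell}}.$$
   Context: The implied constant may depend on $\ell$ but not on $p,H,N$. *)

(* Defs.v *)
From HB Require Import structures.
From mathcomp Require Import all_boot all_order all_algebra.
From mathcomp Require Import all_classical all_reals all_analysis.

Set Implicit Arguments.
Unset Strict Implicit.
Unset Printing Implicit Defensive.

(* The tuple (n_1, ..., n_{2l}) is indexed from 0: the indices i < l carry
   n_1, ..., n_l and the indices l <= i < 2l carry n_{l+1}, ..., n_{2l}.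
   The upper bound n_i <= H + N is carried by the type 'I_(H + N).+1. *)
Definition fact_congr_sols (p l H N : nat) :
    {set {ffun 'I_(2 * l) -> 'I_(H + N).+1}} :=
  [set n : {ffun 'I_(2 * l) -> 'I_(H + N).+1} |
     [forall i, (H.+1 <= n i)%N] &&
     (\prod_(i < 2 * l | (i < l)%N) (n i)`! ==
      \prod_(i < 2 * l | (l <= i)%N) (n i)`! %[mod p])%N].

Definition I_count (p l H N : nat) : nat := #|fact_congr_sols p l H N|.

(* Main.v *)
Require Import Defs.
From HB Require Import structures.
From mathcomp Require Import all_boot all_order all_algebra.
From mathcomp Require Import all_classical all_reals all_analysis.
From mathcomp Require Import zify ring.

Set Implicit Arguments.
Unset Strict Implicit.
Unset Printing Implicit Defensive.
Import Order.TTheory GRing.Theory Num.Theory.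

(** Let [E l] be the number of solutions, written as the sum over the residues
    [c] of the squared number of representations of [c] by products of [l]
    factorials. Cut the interval into about [N / K] blocks of length [K] and
    apply Cauchy-Schwarz over the block containing [n_1]: up to a factor
    [N / K], one may assume that [n_1] and [n_(l+1)] lie in the same block. The
    solutions with [n_1 = n_(l+1)] contribute [N * E (l - 1)]. If they differ by
    [k > 0], then for given values of the other variables [n_1] is a root of a
    nonzero polynomial of degree [k < K], whence a contribution
    [O (K ^ 2 * N ^ (2 l - 2))]. The choice [K = N ^ (2 ^ - l)] balances the two
    terms, and the induction starts at [E 0 = 1]. *)


(** * Concatenation of tuples and Cauchy-Schwarz *)

Definition ffun_cat (A : finType) (m n : nat)
    (f : {ffun 'I_m -> A}) (g : {ffun 'I_n -> A}) : {ffun 'I_(m + n) -> A} :=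
  [ffun i => match fintype.split i with inl j => f j | inr j => g j end].

Lemma ffun_catl (A : finType) m n (f : {ffun 'I_m -> A}) (g : {ffun 'I_n -> A}) j :
  ffun_cat f g (lshift n j) = f j.
Proof. by rewrite ffunE (fintype.unsplitK (inl j)). Qed.

Lemma ffun_catr (A : finType) m n (f : {ffun 'I_m -> A}) (g : {ffun 'I_n -> A}) j :
  ffun_cat f g (rshift m j) = g j.
Proof. by rewrite ffunE (fintype.unsplitK (inr j)). Qed.

Lemma sum_ffun_cat (A : finType) m n (G : {ffun 'I_(m + n) -> A} -> nat) :
  \sum_f G f = \sum_f \sum_g G (ffun_cat f g).
Proof.
rewrite pair_big /= (reindex (fun u => ffun_cat u.1 u.2)) //=.
exists (fun f => ([ffun i => f (lshift n i)], [ffun i => f (rshift m i)])).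
  move=> [f g] _ /=; congr pair; apply/ffunP=> i; rewrite ffunE.
    exact: ffun_catl.
  exact: ffun_catr.
move=> f _ /=; apply/ffunP=> i; rewrite ffunE -[in RHS](fintype.splitK i).
by case: (fintype.split i) => j /=; rewrite ffunE.
Qed.

Lemma all_ffun_cat (A : finType) (P : pred A) m n
    (f : {ffun 'I_m -> A}) (g : {ffun 'I_n -> A}) :
  [forall i, P (ffun_cat f g i)] = [forall i, P (f i)] && [forall i, P (g i)].
Proof.
apply/forallP/andP => [h|[/forallP h1 /forallP h2] i].
  by split; apply/forallP=> i; [have := h (lshift n i) | have := h (rshift m i)];
    rewrite ?ffun_catl ?ffun_catr.
by rewrite ffunE; case: (fintype.split i).
Qed.

(** Cauchy-Schwarz against the constant 1: sum [2 x y <= x ^ 2 + y ^ 2] over all pairs of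
    indices. *)
Lemma sqr_sum_le M (x : 'I_M -> nat) :
  (\sum_j x j) ^ 2 <= M * \sum_j x j ^ 2.
Proof.
rewrite -(leq_pmul2l (isT : 0 < 2)) -mulnn big_distrlr /=.
have -> : 2 * (M * \sum_j x j ^ 2) = \sum_i \sum_j (x i ^ 2 + x j ^ 2).
  under [RHS]eq_bigr do rewrite big_split /= sum_nat_const card_ord.
  by rewrite big_split /= -big_distrr /= sum_nat_const card_ord mul2n addnn.
rewrite big_distrr leq_sum // => i _; rewrite big_distrr leq_sum // => j _.
exact: nat_Cauchy.
Qed.

Lemma eq_mulr_div (F : fieldType) (x y z : F) :
  y != 0%R -> (x * y == z)%R = (x == z / y)%R.
Proof. by move=> y0; apply/eqP/eqP => [<-|->]; rewrite ?mulfK ?divfK. Qed.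

(** * Products of [l] values in a finite field *)

Section ProductRepresentations.
Variables (F : finFieldType) (A : finType) (P : pred A) (f : A -> F).
Hypothesis f_neq0 : forall a, P a -> f a != 0%R.

Definition prod_reps (l : nat) (c : F) : nat :=
  \sum_(t : {ffun 'I_l -> A})
    ([forall i, P (t i)] && ((\prod_i f (t i))%R == c)).

(** The multiplicative energy: expanding the square counts pairs of [l]-tuples with equal
    products. *)
Definition prod_energy (l : nat) : nat := \sum_c prod_reps l c ^ 2.

Lemma sum_eq_op (c : F) (G : F -> nat) : \sum_d (d == c) * G d = G c.
Proof.
rewrite (bigD1 c) //= eqxx mul1n big1 ?addn0 // => d /negPf ->.
by rewrite mul0n.
Qed.

Lemma prod_reps0 c : prod_reps 0 c = (1%R == c).
Proof.
rewrite /prod_reps (eq_bigr (fun=> (1%R == c) : nat)) => [|t _].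
  by rewrite sum_nat_const card_ffun card_ord expn0 mul1n.
by rewrite big_ord0; case: forallP => // -[] [].
Qed.

Lemma prod_energy0 : prod_energy 0 = 1.
Proof.
rewrite /prod_energy; under eq_bigr => c _ do
  rewrite prod_reps0 eq_sym -mulnn.
by rewrite sum_eq_op eqxx.
Qed.

Lemma prod_repsS l c :
  prod_reps l.+1 c = \sum_(a | P a) prod_reps l (c / f a)%R.
Proof.
have all1 a : [forall i : 'I_1, P ([ffun=> a] i)] = P a.
  by apply/forallP/idP => [/(_ ord0)|Pa i]; rewrite ffunE.
rewrite /prod_reps -[l.+1]add1n sum_ffun_cat.
rewrite (reindex (fun a => [ffun _ : 'I_1 => a])) /=; last first.
  exists (fun g : {ffun 'I_1 -> A} => g ord0) => [a _|g _]; first by rewrite ffunE.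
  by apply/ffunP=> i; rewrite ffunE [i]ord1; congr (g _); apply: val_inj.
rewrite [RHS]big_mkcond; apply: eq_bigr => a _ /=; case: ifPn => Pa; last first.
  by apply: big1 => g _; rewrite all_ffun_cat all1 (negPf Pa).
apply: eq_bigr => g _; rewrite all_ffun_cat all1 Pa /=.
congr (nat_of_bool (_ && _)).
rewrite big_split_ord /= big_ord1 ffun_catl ffunE.
under eq_bigr do rewrite ffun_catr.
by rewrite mulrC eq_mulr_div ?f_neq0.
Qed.

(** Disposes of [u = 0] and [v = 0], which the counting hypothesis of the energy recursion
    excludes. *)
Lemma prod_reps_at0 l : prod_reps l 0%R = 0.
Proof.
apply: big1 => t _; case: forallP => //= h.
by apply/eqP; rewrite eqb0; apply/prodf_neq0 => i _; apply: f_neq0.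
Qed.

(** For each first factor [a], multiplication by [f a] permutes the field, so each step contributes
    a factor [#|P|]. *)
Lemma sum_prod_reps l : \sum_c prod_reps l c = #|P| ^ l.
Proof.
elim: l => [|l IH].
  under eq_bigr => c _ do rewrite prod_reps0 eq_sym -[nat_of_bool _]muln1.
  by rewrite sum_eq_op.
under eq_bigr do rewrite prod_repsS.
rewrite exchange_big /= expnS -sum_nat_const; apply: eq_bigr => a Pa.
rewrite -IH (reindex (fun c => c * f a)%R) /=.
  by apply: eq_bigr => c _; rewrite mulfK ?f_neq0.
by exists (fun c => c / f a)%R => c _; rewrite ?mulfK ?divfK ?f_neq0.
Qed.

(** The substitution [c = u * f a] brings out the equation [u * f a = v * f a'], to be counted for
    fixed [u] and [v]. *)
Lemma sum_prod_repsM l a a' : P a -> P a' ->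
  \sum_c prod_reps l (c / f a)%R * prod_reps l (c / f a')%R =
  \sum_u \sum_v (u * f a == v * f a')%R * (prod_reps l u * prod_reps l v).
Proof.
move=> Pa Pa'; rewrite (reindex (fun c => c * f a)%R) /=; last first.
  by exists (fun c => c / f a)%R => c _; rewrite ?mulfK ?divfK ?f_neq0.
apply: eq_bigr => u _; rewrite mulfK ?f_neq0 //.
rewrite -[LHS](sum_eq_op _ (fun v => prod_reps l u * prod_reps l v)).
apply: eq_bigr => v _; congr (nat_of_bool _ * _).
by rewrite [RHS]eq_sym eq_mulr_div ?f_neq0.
Qed.

(* Cauchy-Schwarz over the blocks of [b] applied to the first factor of each
   product; [B] bounds the contribution of distinct first factors. *)
Lemma prod_energyS_le M (b : A -> 'I_M) (B l : nat) :
  (forall u v : F, u != 0%R -> v != 0%R ->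
    \sum_(a | P a) \sum_(a' | P a')
      [&& a != a', b a == b a' & (u * f a == v * f a')%R] <= B) ->
  prod_energy l.+1 <= M * (#|P| * prod_energy l + B * #|P| ^ (2 * l)).
Proof.
move=> hB.
pose h a c := prod_reps l (c / f a)%R.
(* Squaring a sum over [M] blocks costs a factor [M] and leaves only pairs from the same block. *)
have step c : prod_reps l.+1 c ^ 2 <=
    M * \sum_(a | P a) \sum_(a' | P a') (b a == b a') * (h a c * h a' c).
  rewrite prod_repsS (partition_big b xpredT) //=.
  apply: leq_trans (sqr_sum_le _) _; rewrite leq_mul2l; apply/orP; right.
  rewrite eq_leq // [RHS](partition_big b xpredT) //=; apply: eq_bigr => j _.
  rewrite -mulnn big_distrlr /=; apply: eq_bigr => a /andP[Pa /eqP ba].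
  rewrite big_mkcondr /=; apply: eq_bigr => a' Pa'.
  by rewrite ba eq_sym; case: eqP; rewrite ?mul1n.
apply: (@leq_trans (\sum_c (M * \sum_(a | P a) \sum_(a' | P a')
    (b a == b a') * (h a c * h a' c)))).
  by apply: leq_sum => c _; apply: step.
rewrite -big_distrr leq_mul2l; apply/orP; right.
rewrite exchange_big /=.
under eq_bigr do rewrite exchange_big /=.
pose T a a' := \sum_c h a c * h a' c.
have Ta a : P a -> T a a = prod_energy l.
  move=> Pa; rewrite /T (reindex (fun c => c * f a)%R) /=.
    by apply: eq_bigr => c _; rewrite /h mulfK ?f_neq0 // mulnn.
  by exists (fun c => c / f a)%R => c _; rewrite ?mulfK ?divfK ?f_neq0.
(* The diagonal gives the energy one level down; distinct [a], [a'] in one block remain. *)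
have -> : \sum_(a | P a) \sum_(a' | P a') \sum_c (b a == b a') * (h a c * h a' c)
  = \sum_(a | P a) T a a + \sum_(a | P a) \sum_(a' | P a')
      ((a != a') && (b a == b a')) * T a a'.
  rewrite -big_split; apply: eq_bigr => a Pa /=.
  rewrite (bigD1 a) //= [in RHS](bigD1 a) //= !eqxx mul0n add0n.
  congr addn; first by apply: eq_bigr => c _; rewrite mul1n.
  apply: eq_bigr => a' /andP[_ ne].
  by rewrite -big_distrr [a == _]eq_sym ne.
apply: leq_add.
  rewrite (eq_bigr (fun=> prod_energy l)) => [|a Pa]; last exact: Ta.
  by rewrite sum_nat_const.
(* With the products [u], [v] of the remaining factors fixed outside, the inner sum is the count
   bounded by [hB]. *)
have -> : \sum_(a | P a) \sum_(a' | P a') ((a != a') && (b a == b a')) * T a a'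
  = \sum_u \sum_v (prod_reps l u * prod_reps l v) *
     \sum_(a | P a) \sum_(a' | P a')
      [&& a != a', b a == b a' & (u * f a == v * f a')%R].
  under [RHS]eq_bigr do under eq_bigr do
    (rewrite big_distrr /=; under eq_bigr do rewrite big_distrr /=).
  under [RHS]eq_bigr do rewrite exchange_big /=.
  rewrite [RHS]exchange_big /=; apply: eq_bigr => a Pa.
  under [RHS]eq_bigr do rewrite exchange_big /=.
  rewrite [RHS]exchange_big /=; apply: eq_bigr => a' Pa'.
  rewrite /T sum_prod_repsM // big_distrr; apply: eq_bigr => u _ /=.
  rewrite big_distrr; apply: eq_bigr => v _ /=.
  by rewrite andbA -[nat_of_bool (_ && (_ == _ :> F))]mulnb mulnA mulnC.
have -> : B * #|P| ^ (2 * l) = \sum_u \sum_v (prod_reps l u * prod_reps l v) * B.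
  under eq_bigr do rewrite -big_distrl -big_distrr /= sum_prod_reps.
  by rewrite -!big_distrl /= sum_prod_reps mulnC mul2n -addnn expnD.
apply: leq_sum => u _; apply: leq_sum => v _.
have [->|u0] := eqVneq u 0%R; first by rewrite prod_reps_at0.
have [->|v0] := eqVneq v 0%R; first by rewrite prod_reps_at0 muln0.
by rewrite leq_mul2l hB ?orbT.
Qed.

Lemma prod_energyE l : prod_energy l =
  \sum_(t : {ffun 'I_l -> A}) \sum_(s : {ffun 'I_l -> A})
    ([forall i, P (t i)] && [forall i, P (s i)] &&
      (\prod_i f (t i) == \prod_i f (s i))%R).
Proof.
rewrite /prod_energy; under eq_bigr do rewrite -mulnn big_distrlr /=.
rewrite exchange_big; apply: eq_bigr => t _ /=.
rewrite exchange_big; apply: eq_bigr => s _ /=.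
rewrite -[RHS](sum_eq_op _ (fun d => [forall i, P (t i)] && [forall i, P (s i)]
   && (d == \prod_i f (s i))%R : nat)).
apply: eq_bigr => c _.
by rewrite !mulnb [c == _]eq_sym [in RHS](eq_sym c) -!andbA; congr nat_of_bool; rewrite andbCA.
Qed.

End ProductRepresentations.

(** * Equations between factorials modulo a prime *)

Lemma sum_ord_eq_le1 n c : \sum_(a < n) (a == c :> nat) <= 1.
Proof.
have [ltcn|lenc] := ltnP c n.
  rewrite (bigD1 (Ordinal ltcn)) //= eqxx big1 // => a /negPf.
  by rewrite -val_eqE /= => ->.
by rewrite big1 // => a _; rewrite ltn_eqF // (leq_trans (ltn_ord a)).
Qed.

Section FactorialModPrime.
Variables (p : nat) (p_pr : prime p).
Local Notation fact_Fp := (fun n : nat => (n`!)%:R%R : 'F_p).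

Lemma eq_natr_Fp m n : (m%:R == n%:R :> 'F_p)%R = (m == n %[mod p]).
Proof.
apply/eqP/eqP => [/(congr1 val) /=|e].
  by rewrite !val_Fp_nat.
by rewrite -(Fp_nat_mod p_pr) e (Fp_nat_mod p_pr).
Qed.

Lemma fact_Fp_neq0 n : n < p -> fact_Fp n != 0%R.
Proof.
rewrite -(dvdn_pcharf (pchar_Fp p_pr)).
elim: n => [|n IHn] ltnp; first by rewrite fact0 gtnNdvd ?prime_gt1.
by rewrite factS Euclid_dvdM // negb_or gtnNdvd // IHn // ltnW.
Qed.

(** The quotient of [(n + k)!] by [n!] is [(n + 1) ... (n + k)], a monic polynomial in [n] with
    roots [-1, ..., -k]. *)
Lemma fact_addn_horner n k : fact_Fp (n + k) =
  (fact_Fp n * (\prod_(i < k) ('X - (- i.+1%:R)%:P)).[n%:R])%R.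
Proof.
elim: k => [|k IHk]; first by rewrite addn0 big_ord0 hornerC mulr1.
rewrite addnS factS mulnC natrM IHk big_ord_recr /= hornerM mulrA hornerXsubC.
by rewrite opprK -natrD addnS.
Qed.

(* [u n! = v (n + k)!] is a polynomial equation of degree [k] in [n]. *)
Lemma count_fact_shift m k (u v : 'F_p) : m <= p -> 0 < k -> v != 0%R ->
  \sum_(a < m) (u * fact_Fp a == v * fact_Fp (a + k)%N)%R <= k.
Proof.
move=> lemp k0 v0.
pose Q : {poly 'F_p} := (\prod_(i < k) ('X - (- i.+1%:R)%:P))%R.
(* Cancelling [a!] makes each solution a root of [q]. As [v] is nonzero and [k > 0], the constant
   [u] cannot kill the leading term. *)
pose q := (v *: Q - u%:P)%R.
have szQ : size Q = k.+1.
  by rewrite size_prod_XsubC /index_enum -enumT size_enum_ord.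
have szq : size q = k.+1.
  rewrite size_polyDl size_scale ?szQ // size_polyN.
  by rewrite (leq_ltn_trans (size_polyC_leq1 _)).
pose rs := [seq (nat_of_ord a)%:R%R : 'F_p |
             a <- enum [pred a : 'I_m | root q ((nat_of_ord a)%:R)%R]].
have rs_lt : size rs < size q.
  apply: max_poly_roots; first by rewrite -size_poly_gt0 szq.
    by apply/allP=> _ /mapP[a + ->]; rewrite mem_enum.
  (* Since [m <= p], distinct [a] are distinct residues, hence distinct roots. *)
  rewrite map_inj_uniq ?enum_uniq // => a a' /eqP; rewrite eq_natr_Fp.
  rewrite !modn_small ?(leq_trans (ltn_ord _)) //.
  by move/eqP/val_inj.
move: rs_lt; rewrite szq size_map -cardE -sum1_card big_mkcond ltnS /=.
apply: leq_trans; apply: leq_sum => a _.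
case: eqP => // e; case: ifPn => //; rewrite inE /root /q !hornerE subr_eq0.
have f0 : fact_Fp a != 0%R by rewrite fact_Fp_neq0 // (leq_trans (ltn_ord a)).
move=> /eqP[]; apply: (mulIf f0); rewrite e fact_addn_horner -/Q.
by rewrite -mulrA; congr (_ * _)%R; rewrite mulrC.
Qed.

(** Write [a' = a + k] with [0 < k < K]: fewer than [K] shifts, each with at most [k <= K]
    solutions. *)
Lemma count_fact_near m K (u v : 'F_p) : m <= p -> v != 0%R ->
  \sum_(a < m) \sum_(a' < m)
    [&& a < a', a' < a + K & (u * fact_Fp a == v * fact_Fp a')%R] <= K ^ 2.
Proof.
move=> lemp v0.
pose E (a k : nat) := (0 < k) && (u * fact_Fp a == v * fact_Fp (a + k)%N)%R.
apply: (@leq_trans (\sum_(a < m) \sum_(a' < m) \sum_(k < K)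
    (a' == a + k :> nat) * E a k)).
  apply: leq_sum => a _; apply: leq_sum => a' _.
  case: (boolP [&& _, _ & _]) => // /and3P[lt1 lt2 e].
  have ltK : a' - a < K by lia.
  rewrite (bigD1 (Ordinal ltK)) //= /E.
  have -> : a + (a' - a) = a' by lia.
  by rewrite eqxx e subn_gt0 lt1.
apply: (@leq_trans (\sum_(a < m) \sum_(k < K) E a k)).
  apply: leq_sum => a _; rewrite exchange_big; apply: leq_sum => k _ /=.
  by rewrite -big_distrl -[leqRHS]mul1n leq_mul2r sum_ord_eq_le1 orbT.
have -> : K ^ 2 = \sum_(k < K) K by rewrite sum_nat_const card_ord mulnn.
rewrite exchange_big /=.
apply: leq_sum => k _; rewrite /E; case: (posnP k) => [->|k0].
  by rewrite big1.
exact: leq_trans (count_fact_shift _ lemp k0 v0) (ltnW (ltn_ord k)).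
Qed.

(** * Energy of the factorials over an interval *)

Variables (H N : nat) (HN_lt : H + N < p).
Local Notation above := (fun a : 'I_(H + N).+1 => H < a).

Lemma card_above : #|above| = N.
Proof.
rewrite -sum1_card big_mkcond -addSn big_split_ord /= big1 ?add0n => [|i _].
  rewrite -[RHS]card_ord -sum1_card; apply: eq_bigr => i _.
  by rewrite unfold_in /= leq_addr.
by rewrite unfold_in /= ltnNge -ltnS ltn_ord.
Qed.

Definition fact_energy :=
  prod_energy above (fun a : 'I_(H + N).+1 => fact_Fp a).

Lemma fact_energyS_le K l : 0 < K ->
  fact_energy l.+1 <=
    (N %/ K).+1 * (N * fact_energy l + (2 * K ^ 2) * N ^ (2 * l)).
Proof.
move=> K0.
(* Blocks of [K] consecutive integers from [H + 1]; the quotient is at most [N %/ K], so [inord]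
   never takes its default value. *)
pose b (a : 'I_(H + N).+1) : 'I_(N %/ K).+1 := inord ((a - H.+1) %/ K).
have fn0 (a : 'I_(H + N).+1) : H < a -> fact_Fp a != 0%R.
  by move=> _; rewrite fact_Fp_neq0 // (leq_trans (ltn_ord a)).
have near (a a' : 'I_(H + N).+1) : H < a -> H < a' -> b a = b a' -> a' < a + K.
  move=> Ha Ha' /(congr1 val) /=.
  have bd (c : 'I_(H + N).+1) : (c - H.+1) %/ K < (N %/ K).+1.
    by rewrite ltnS leq_div2r //; have := ltn_ord c; lia.
  rewrite !inordK // => e.
  have := divn_eq (a - H.+1) K; have := divn_eq (a' - H.+1) K.
  have := ltn_pmod (a - H.+1) K0; have := ltn_pmod (a' - H.+1) K0.
  rewrite e; lia.
have := @prod_energyS_le _ _ _ _ fn0 _ b (2 * K ^ 2) l.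
rewrite card_above; apply=> u v u0 v0.
(* The two orders [a < a'] and [a' < a] account for the factor 2; the second one swaps [u] and
   [v]. *)
have c1 := @count_fact_near (H + N).+1 K u v HN_lt v0.
have c2 := @count_fact_near (H + N).+1 K v u HN_lt u0.
rewrite mul2n -addnn; apply: leq_trans (leq_add c1 c2).
rewrite [X in _ <= _ + X]exchange_big -big_split /= big_mkcond; apply: leq_sum => a _.
case: ifP => // Ha; rewrite -big_split /= big_mkcond; apply: leq_sum => a' _.
case: ifP => // Ha'; case: and3P => // -[ne /eqP eb e].
rewrite e [(v * _)%R == _]eq_sym e (near _ _ Ha Ha' eb) (near _ _ Ha' Ha (esym eb)).
by move: ne; rewrite neq_ltn => /orP[] ->; rewrite ?addn1 ?addnS.
Qed.

Lemma I_countE l : I_count p l H N = fact_energy l.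
Proof.
rewrite /fact_energy prod_energyE /I_count /fact_congr_sols -sum1_card big_mkcond /=.
(* [2 * l] occurs in types, so it is generalized before becoming [l + l]. *)
move: (2 * l) (mul2n l); rewrite -addnn => _ ->.
rewrite sum_ffun_cat; apply: eq_bigr => t _; apply: eq_bigr => s _ /=.
have /= all_cat := all_ffun_cat above t s.
rewrite inE all_cat !big_split_ord /=.
under eq_bigl do rewrite ltn_ord.
rewrite [X in _ * X == _ %[mod p]]big_pred0 ?muln1; last first.
  by move=> i; rewrite ltnNge leq_addr.
rewrite [X in _ == X * _ %[mod p]]big_pred0 ?mul1n; last first.
  by move=> i; rewrite leqNgt ltn_ord.
under [X in _ == X %[mod p]]eq_bigl do rewrite leq_addr.
rewrite -eq_natr_Fp !natr_prod.
under eq_bigr do rewrite ffun_catl.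
under [X in _ && (_ == X)]eq_bigr do rewrite ffun_catr.
by case: ifP.
Qed.

End FactorialModPrime.

(** * Real exponents and the final bound *)

Local Open Scope ring_scope.

(** The extra factor [N] on both sides turns the exponent [2 l - 1] into the natural number [2 l],
    even at [l = 0]. *)
Lemma fact_energy_le (R : realType) (l : nat) :
  exists2 C : R, 0 < C &
    forall p H N : nat, prime p -> (0 < N)%N -> (H + N < p)%N ->
      (fact_energy p H N l)%:R * N%:R <= C * N%:R ^+ (2 * l) * N%:R `^ (2 ^- l).
Proof.
elim: l => [|l [C C0 IH]].
  exists 1 => // p H N _ N0 _.
  by rewrite /fact_energy prod_energy0 muln0 !expr0 invr1 powRr1 // !mul1r.
(* The 4 comes from the number of blocks, [C] from the diagonal by induction, and 2 from the
   off-diagonal term. *)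
exists (4 * (C + 2)) => [|p H N pp N0 HN]; first by rewrite mulr_gt0 // addr_gt0.
have N1 : 1 <= N%:R :> R by rewrite ler1n.
pose x : R := N%:R `^ (2 ^- l.+1).
(* Hence the inductive bound and the term in [K ^ 2] are both of size [N ^ (2 l) x ^ 2]. *)
have x2 : N%:R `^ (2 ^- l) = x ^+ 2.
  rewrite -powR_mulrn ?powR_ge0 // -powRrM; congr (_ `^ _).
  by rewrite exprS invfM mulrAC mulVf ?mul1r.
have x1 : 1 <= x by rewrite -(powRr0 (N%:R : R)) ler_powR // invr_ge0 exprn_ge0.
have xN : x <= N%:R by rewrite ler1_powR // invf_le1 ?exprn_gt0 // exprn_ege1 // ler1n.
(* [K = N ^ (2 ^ - (l + 1))], up to rounding, balances the two terms of the recursion. *)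
pose K := Num.truncn x.
have x0 : 0 <= x by rewrite (le_trans ler01).
have /andP[Kx xK] := truncn_itv x0.
have K0 : (0 < K)%N by rewrite truncn_gt0.
have KN : (K <= N)%N by rewrite -(ler_nat R) (le_trans Kx).
have mK : ((N %/ K).+1 * K <= 2 * N)%N.
  by rewrite mulSn mul2n -addnn leq_add // leq_trunc_div.
have mx : (N %/ K).+1%:R * x <= 4 * N%:R :> R.
  (* Rounding down loses at most a factor 2: [x < K + 1 <= 2 K]. *)
  have x2K : x <= 2 * K%:R.
    by rewrite (le_trans (ltW xK)) // -natrM ler_nat mul2n -addnn -addn1 leq_add2l.
  apply: (le_trans (ler_wpM2l (ler0n _ _) x2K)).
  rewrite -!natrM ler_nat mulnCA; move: mK; set q := (_ * K)%N; lia.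
have := fact_energyS_le pp HN l K0; rewrite -(ler_nat R) => hE.
rewrite -/x; apply: (le_trans (ler_wpM2r (ler0n _ _) hE)).
have := IH p H N pp N0 HN; rewrite x2.
rewrite natrM natrD !natrM !natrX mulnS exprD.
move: (N %/ K).+1%:R mx (ler0n R (N %/ K).+1) => m mx m0 hI.
set P := N%:R ^+ (2 * l) in hI *; have P0 : 0 <= P by rewrite exprn_ge0.
have K2 : K%:R ^+ 2 <= x ^+ 2 by rewrite lerXn2r ?nnegrE.
have h1 : N%:R * (fact_energy p H N l)%:R + 2 * K%:R ^+ 2 * P <= (C + 2) * P * x ^+ 2.
  rewrite mulrC (_ : (C + 2) * P * x ^+ 2 = C * P * x ^+ 2 + 2 * x ^+ 2 * P).
    by rewrite lerD // ler_wpM2r // ler_wpM2l.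
  by rewrite !mulrDl; congr (_ + _); rewrite mulrAC.
apply: (@le_trans _ _ (m * ((C + 2) * P * x ^+ 2) * N%:R)).
  by rewrite ler_wpM2r // ler_wpM2l.
(* One factor of [x ^ 2] pays for the number [m] of blocks. *)
rewrite [leLHS](_ : _ = (m * x) * ((C + 2) * P * x * N%:R)); last by ring.
rewrite [leRHS](_ : _ = (4 * N%:R) * ((C + 2) * P * x * N%:R)); last by ring.
by rewrite ler_wpM2r // !mulr_ge0 // addr_ge0 // ltW.
Qed.

Theorem theorem6 (R : realType) (l : nat) (hl : (1 <= l)%N) :
  exists2 C : R, 0 < C &
    forall p H N : nat, prime p -> odd p ->
      (0 <= H)%N -> (H < H + N)%N -> (H + N < p)%N ->
      (I_count p l H N)%:R <= C * N%:R `^ ((2 * l)%:R - 1 + 2 ^- l).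
Proof.
have [C C0 hC] := fact_energy_le R l; exists C => // p H N pp _ _ HN HNp.
have N0 : (0 < N)%N by rewrite -(ltn_add2l H) addn0.
have NR0 : 0 < N%:R :> R by rewrite ltr0n.
have Nn0 : N%:R != 0 :> R by rewrite gt_eqF.
(* The factor [N ^ -1] of the split power moves to the left, giving the form of [fact_energy_le]. *)
rewrite I_countE // !powRD ?Nn0 ?implybT // powR_mulrn ?ler0n // powR_inv1 ?ler0n //.
by rewrite mulrAC mulrA ler_pdivlMr // mulrA hC.
Qed.
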